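(* Let $G=(V,E)$ be a (finite simple) graph, $L(G)$ its line graph and $M_G$ its graphic matroid, viewed as a simplicial complex on $E$. Then the simplicial complex of sets of pairwise-compatible subtrees of $G$ is equal to the tubing complex of the $M_G$-graph $L(G)$.
   Context: The graphic matroid $M_G$ is the simplicial complex on base set $E$ whose faces are the $E'\subseteq E$ such that $(V,E')$ contains no cycles. The line graph $L(G)$ has vertex set $E$, with $\{e_1,e_2\}$ an edge whenever the distinct edges $e_1,e_2\in E$ share a vertex of $G$. A subtree of $G$ is a (nonempty) set of edges of $G$ which form a tree; its vertex set is the union of its edges. Two subtrees $t_1,t_2$ are compatible if $t_1\subseteq t_2$, or $t_2\subseteq t_1$, or the vertex sets of $t_1,t_2$ are disjoint. For a simplicial complex $\Delta$ on base set $\mathcal{S}$, a $\Delta$-graph is a graph on vertex set $\mathcal{S}$ all of whose edges are faces of $\Delta$. A tube of a $\Delta$-graph is a nonempty face of $\Delta$ that induces a connected subgraph. Two tubes $t_1,t_2$ are weakly compatible if $t_1\subset t_2$, or $t_2\subset t_1$, or $t_1\cap t_2=\emptyset$ and there is no edge between a vertex of $t_1$ and a vertex of $t_2$. A tubing is a set $T$ of pairwise weakly compatible tubes such that $\bigcup_{t\in T}t$ is a face of $\Delta$. The tubing complex is the simplicial complex of all tubings. *)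

(* Defs.v *)
From HB Require Import structures.
From mathcomp Require Import all_boot.

Set Implicit Arguments.
Unset Strict Implicit.
Unset Printing Implicit Defensive.

Section Graphs.

Variable V : finType.

Record sgraph := SGraph {
  adj :> rel V;
  adj_sym : symmetric adj;
  adj_irr : irreflexive adj }.

Definition edges (G : sgraph) : {set {set V}} :=
  [set [set p.1; p.2] | p : V * V & adj G p.1 p.2].

(* The subgraph of G induced on A is connected (true when A is empty). *)
Definition connected_on (G : sgraph) (A : {set V}) : bool :=
  [forall x in A, forall y in A,
     connect [rel u v | [&& u \in A, v \in A & G u v]] x y].

(* A cycle is a cyclic sequence of at least 3 distinct, consecutively adjacent
   vertices. Its length is at most #|V|, so that the quantification below is
   exhaustive; see acyclicP. *)
Definition acyclic (G : sgraph) : bool :=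
  [forall k : 'I_#|V|.+1, forall c : k.-tuple V, (2 < k) ==> ~~ ucycleb G c].

Lemma acyclicP (G : sgraph) :
  reflect (forall c : seq V, 2 < size c -> ~ ucycle G c) (acyclic G).
Proof.
apply: (iffP forallP) => [acG c c_gt2 Gc | acG k].
  have lt_c : size c < #|V|.+1.
    by case/andP: Gc => _ /card_uniqP <-; rewrite ltnS max_card.
  move/forallP/(_ (in_tuple c)): (acG (Ordinal lt_c)).
  by rewrite /= c_gt2 /= [ucycleb _ _]Gc.
apply/forallP=> c; apply/implyP=> k_gt2; apply/negP.
by apply: acG; rewrite size_tuple.
Qed.

End Graphs.

Section Complexes.

Variable S : finType.

Definition is_complex (F : {set {set S}}) : bool :=
  (set0 \in F) &&
  [forall A in F, forall B : {set S}, (B \subset A) ==> (B \in F)].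

(* Not every point of S is required to be a face. *)
Record scomplex := SComplex {
  faces : {set {set S}};
  facesP : is_complex faces }.

HB.instance Definition _ := [isSub for faces].

Lemma is_complexI (F : {set {set S}}) :
  set0 \in F -> (forall A B : {set S}, A \in F -> B \subset A -> B \in F) ->
  is_complex F.
Proof.
move=> F0 FS; rewrite /is_complex F0.
apply/forall_inP=> A FA; apply/forallP=> B; apply/implyP; exact: FS.
Qed.

Lemma face0 (D : scomplex) : set0 \in faces D.
Proof. by case/andP: (facesP D). Qed.

Lemma faceS (D : scomplex) (A B : {set S}) :
  A \in faces D -> B \subset A -> B \in faces D.
Proof.
by case/andP: (facesP D) => _ /forall_inP FS /FS/forallP/(_ B)/implyP.
Qed.

(* r holds for any two distinct elements of T. *)
Definition pairwise_on (r : rel S) (T : {set S}) : bool :=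
  [forall x in T, forall y in T, (x != y) ==> r x y].

Lemma pairwise_onS (r : rel S) (T U : {set S}) :
  pairwise_on r T -> U \subset T -> pairwise_on r U.
Proof.
move=> /forall_inP rT /subsetP sUT; apply/forall_inP=> x /sUT/rT/forall_inP rx.
by apply/forall_inP=> y /sUT/rx.
Qed.

End Complexes.

Section Tubings.

Variables (S : finType) (D : scomplex S) (H : sgraph S).

Definition delta_graph : bool := edges H \subset faces D.

Definition tube (t : {set S}) : bool :=
  [&& t != set0, t \in faces D & connected_on H t].

Definition weakly_compatible (t1 t2 : {set S}) : bool :=
  [|| t1 \proper t2, t2 \proper t1
    | [disjoint t1 & t2] && [forall x in t1, forall y in t2, ~~ H x y]].

Definition tubing (T : {set {set S}}) : bool :=
  [&& [forall t in T, tube t], pairwise_on weakly_compatible T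
    & \bigcup_(t in T) t \in faces D].

Fact tubing_complex_subproof : is_complex [set T | tubing T].
Proof.
apply: is_complexI => [|A B]; rewrite !inE.
  rewrite /tubing big_set0 face0 andbT; apply/andP.
  by split; apply/forall_inP=> t; rewrite inE.
case/and3P=> /forall_inP tA cA fA sBA; apply/and3P; split.
- by apply/forall_inP=> t /(subsetP sBA)/tA.
- exact: pairwise_onS cA sBA.
- apply: faceS fA _; apply/bigcupsP=> t /(subsetP sBA) At.
  exact: bigcup_sup At.
Qed.

Definition tubing_complex : scomplex {set S} :=
  SComplex tubing_complex_subproof.

End Tubings.

Section GraphicMatroid.

Variables (V : finType) (G : sgraph V).

Definition edge : finType := {e : {set V} | e \in edges G}.

Implicit Types A B t : {set edge}.

Definition spanning_adj A : rel V :=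
  [rel x y | [exists e in A, val e == [set x; y]]].

Fact spanning_adj_sym A : symmetric (spanning_adj A).
Proof. by move=> x y /=; apply: eq_existsb => e; rewrite setUC. Qed.

Fact spanning_adj_irr A : irreflexive (spanning_adj A).
Proof.
move=> x /=; apply/existsP => -[[e eG] /andP[_ /= /eqP De]].
case/imsetP: eG => -[u v]; rewrite inE /= => Guv; rewrite De setUid => Dx.
have/set1P Du : u \in [set x] by rewrite Dx set21.
have/set1P Dv : v \in [set x] by rewrite Dx set22.
by rewrite Du Dv adj_irr in Guv.
Qed.

(* The graph (V, A). *)
Definition spanning_subgraph A : sgraph V :=
  SGraph (spanning_adj_sym A) (@spanning_adj_irr A).

Lemma acyclic_spanningS A B :
  acyclic (spanning_subgraph A) -> B \subset A ->
  acyclic (spanning_subgraph B).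
Proof.
move=> /acyclicP acA /subsetP sBA; apply/acyclicP=> c c_gt2 /andP[cB Uc].
apply: (acA c c_gt2); rewrite /ucycle Uc andbT.
apply: sub_cycle cB => x y /existsP[e /andP[/sBA Ae De]].
by apply/existsP; exists e; rewrite Ae.
Qed.

Lemma acyclic_spanning0 : acyclic (spanning_subgraph set0).
Proof.
apply/acyclicP=> -[|x [|y c]] // _ /andP[/andP[/existsP[e]]].
by rewrite inE.
Qed.

Fact graphic_matroid_subproof :
  is_complex [set A | acyclic (spanning_subgraph A)].
Proof.
apply: is_complexI => [|A B]; rewrite !inE; first exact: acyclic_spanning0.
exact: acyclic_spanningS.
Qed.

Definition graphic_matroid : scomplex edge :=
  SComplex graphic_matroid_subproof.

Definition line_adj : rel edge :=
  [rel e f | (e != f) && (val e :&: val f != set0)].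

Fact line_adj_sym : symmetric line_adj.
Proof. by move=> e f; rewrite /line_adj /= eq_sym setIC. Qed.

Fact line_adj_irr : irreflexive line_adj.
Proof. by move=> e; rewrite /line_adj /= eqxx. Qed.

Definition line_graph : sgraph edge := SGraph line_adj_sym line_adj_irr.

Definition vertex_set t : {set V} := \bigcup_(e in t) val e.

(* The graph (vertex_set t, t) is a tree; it is the subgraph of (V, t) induced
   on vertex_set t, and has the same cycles as (V, t). *)
Definition subtree t : bool :=
  [&& t != set0, connected_on (spanning_subgraph t) (vertex_set t)
    & acyclic (spanning_subgraph t)].

Definition compatible t1 t2 : bool :=
  [|| t1 \subset t2, t2 \subset t1
    | [disjoint vertex_set t1 & vertex_set t2]].

Definition compatible_subtrees (T : {set {set edge}}) : bool :=
  [forall t in T, subtree t] && pairwise_on compatible T.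

Fact subtree_complex_subproof : is_complex [set T | compatible_subtrees T].
Proof.
apply: is_complexI => [|A B]; rewrite !inE.
  by apply/andP; split; apply/forall_inP=> t; rewrite inE.
case/andP=> /forall_inP tA cA sBA; apply/andP; split.
  by apply/forall_inP=> t /(subsetP sBA)/tA.
exact: pairwise_onS cA sBA.
Qed.

Definition subtree_complex : scomplex {set edge} :=
  SComplex subtree_complex_subproof.

End GraphicMatroid.

(* Main.v *)
(** The clauses defining tubes and subtrees, and those defining the two
    compatibility relations, match one by one: a walk in (V, t) and a walk in
    the line graph on t translate into each other, and two sets of edges meet
    or are joined in the line graph exactly when they share a vertex of G. It
    remains to see that the union of pairwise compatible subtrees is acyclic:
    a cycle in the union has an edge in some inclusion-maximal t of the
    family, and compatibility prevents a walk in the union from leaving t, so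
    the cycle lies in t. *)

Require Import Defs.
From mathcomp Require Import all_boot.

Set Implicit Arguments.
Unset Strict Implicit.
Unset Printing Implicit Defensive.

Section SubtreesAndTubes.

Variables (V : finType) (G : sgraph V).

Implicit Types (A B t : {set edge G}) (e f : edge G) (T : {set {set edge G}}).

Lemma edgeP e : exists u v : V, u != v /\ val e = [set u; v].
Proof.
case: e => e /= /imsetP[[u v]]; rewrite inE /= => Guv ->.
by exists u, v; split=> //; apply: contraTneq Guv => ->; rewrite adj_irr.
Qed.

Lemma vertex_setP t x :
  reflect (exists2 e, e \in t & x \in val e) (x \in vertex_set t).
Proof. exact: bigcupP. Qed.

Lemma spanning_adjP t x y :
  reflect (exists2 e, e \in t & val e = [set x; y]) (spanning_adj t x y).
Proof.
apply: (iffP existsP) => [[e /andP[te /eqP De]] | [e te De]]; exists e => //.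
by rewrite te De eqxx.
Qed.

Lemma line_graph_connect_meet t e f x :
  e \in t -> f \in t -> x \in val e -> x \in val f ->
  connect [rel u v | [&& u \in t, v \in t & line_graph G u v]] e f.
Proof.
move=> te tf ex fx; have [<-|neq_ef] := eqVneq e f; first exact: connect0.
apply: connect1; apply/and3P; split=> //; apply/andP; split=> //.
by apply/set0Pn; exists x; rewrite inE ex fx.
Qed.

Lemma spanning_connect_edge t e x y :
  e \in t -> x \in val e -> y \in val e ->
  connect [rel u v | [&& u \in vertex_set t, v \in vertex_set t
                       & spanning_subgraph t u v]] x y.
Proof.
move=> te ex ey; have [<-|neq_xy] := eqVneq x y; first exact: connect0.
apply: connect1; apply/and3P; split; try by apply/vertex_setP; exists e.
apply/spanning_adjP; exists e => //; have [u [v [neq_uv De]]] := edgeP e.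
(* An edge has exactly two elements, so the distinct vertices [x] and [y] exhaust it. *)
apply/esym/eqP; rewrite eqEcard subUset !sub1set ex ey De !cards2 neq_uv.
by rewrite neq_xy.
Qed.

(** Both inductions on a walk carry an edge [e] of [t] together with a vertex [x] on it. A
    line-graph step from [e] to [g] becomes a move inside [e] from [x] to a vertex shared with [g];
    a vertex step from [x] to [z] becomes a move from [e] to the edge joining [x] and [z], which
    meets [e] at [x]. *)
Lemma connected_on_line_graph t :
  connected_on (line_graph G) t =
  connected_on (spanning_subgraph t) (vertex_set t).
Proof.
apply/forall_inP/forall_inP => [Lt x /vertex_setP[e te ex] | St e te].
  apply/forall_inP=> y /vertex_setP[f tf fy].
  have /connectP[p] := forall_inP (Lt e te) f tf.
  elim: p e x te ex => [|g p IHp] e x te ex /=.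
    by move=> _ Df; apply: (spanning_connect_edge te); rewrite // -Df.
  case/andP=> /and3P[_ tg /andP[_ /set0Pn[z]]]; rewrite inE => /andP[ez gz].
  move=> gp Df; apply: connect_trans (IHp g z tg gz gp Df).
  exact: (spanning_connect_edge te).
apply/forall_inP=> f tf.
have [x ex] : exists x, x \in val e.
  by have [u [v [_ ->]]] := edgeP e; exists u; rewrite set21.
have [y fy] : exists y, y \in val f.
  by have [u [v [_ ->]]] := edgeP f; exists u; rewrite set21.
have tx : x \in vertex_set t by apply/vertex_setP; exists e.
have ty : y \in vertex_set t by apply/vertex_setP; exists f.
have /connectP[p] := forall_inP (St x tx) y ty.
elim: p e x te ex {tx} => [|z p IHp] e x te ex /=.
  by move=> _ Dy; apply: (line_graph_connect_meet te tf ex); rewrite -Dy.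
case/andP=> /and3P[_ _ /spanning_adjP[g tg Dg]] zp Dy.
have gz : z \in val g by rewrite Dg set22.
apply: connect_trans (IHp g z tg gz zp Dy).
by apply: (line_graph_connect_meet te tg ex); rewrite Dg set21.
Qed.

Lemma tube_subtree t : tube (graphic_matroid G) (line_graph G) t = subtree t.
Proof.
by rewrite /tube /subtree connected_on_line_graph inE [X in _ && X]andbC.
Qed.

(** Adjacency in the line graph is irreflexive, so a vertex shared by an edge of [A] and an edge of
    [B] means either a common edge or two adjacent ones. Conversely, a common edge yields a common
    vertex because edges are nonempty. *)
Lemma disjoint_vertex_set A B :
  [disjoint vertex_set A & vertex_set B] =
  [disjoint A & B] && [forall e in A, forall f in B, ~~ line_graph G e f].
Proof.
apply/idP/andP => [dAB | [dAB /forall_inP nAB]].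
  have notAB e f x : e \in A -> f \in B -> x \in val e -> x \notin val f.
    move=> Ae Bf ex; apply/negP=> fx; move/pred0P: dAB => /(_ x) /=.
    case/andP; split; apply/vertex_setP; first by exists e.
    by exists f.
  split.
    apply/pred0P=> e /=; apply/andP=> -[Ae Be].
    have [u [v [_ De]]] := edgeP e.
    by have := notAB e e u Ae Be; rewrite De set21 => /(_ isT).
  apply/forall_inP=> e Ae; apply/forall_inP=> f Bf; apply/negP=> /andP[_].
  by case/set0Pn=> x /setIP[ex fx]; have /negP := notAB e f x Ae Bf ex.
apply/pred0P=> x /=; apply/andP=> -[/vertex_setP[e Ae ex] /vertex_setP[f Bf fx]].
have neq_ef : e != f.
  by apply: contraTneq Bf => <-; rewrite (disjointFr dAB Ae).
have /negP[] := forall_inP (nAB e Ae) f Bf; apply/andP; split=> //.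
by apply/set0Pn; exists x; rewrite inE ex.
Qed.

(** Strict and weak inclusion differ only on equal sets, and [pairwise_on] compares distinct
    elements only. *)
Lemma weakly_compatibleE A B :
  A != B -> weakly_compatible (line_graph G) A B = compatible A B.
Proof.
move=> neqAB; rewrite /weakly_compatible /compatible disjoint_vertex_set.
by rewrite !properEneq neqAB eq_sym neqAB.
Qed.

Lemma pairwise_weakly_compatible T :
  pairwise_on (weakly_compatible (line_graph G)) T =
  pairwise_on (@compatible V G) T.
Proof.
apply: eq_forallb => A; congr (_ ==> _); apply: eq_forallb => B.
congr (_ ==> _); have [//|neqAB] := eqVneq A B.
by rewrite weakly_compatibleE.
Qed.

(** A member [s] of [T] containing the edge from [x] to [y] shares the vertex [x] with [t], so
    compatibility makes the two comparable, and maximality of [t] puts [s] inside it. *)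
Lemma spanning_adj_maximal T t x y :
    pairwise_on (@compatible V G) T -> maxset [in T] t ->
    x \in vertex_set t -> spanning_adj (\bigcup_(s in T) s) x y ->
  spanning_adj t x y.
Proof.
move=> /forall_inP cT /maxsetP[/= Tt max_t] tx.
case/spanning_adjP=> e /bigcupP[s Ts se] De; apply/spanning_adjP; exists e => //.
have [-> //|neq_ts] := eqVneq t s.
have /implyP/(_ neq_ts) := forall_inP (cT t Tt) s Ts.
case/or3P=> [sts | /subsetP-> // | dts].
  by rewrite -(max_t s Ts sts).
have sx : x \in vertex_set s by apply/vertex_setP; exists e; rewrite // De set21.
by rewrite (disjointFr dts tx) in sx.
Qed.

Lemma spanning_path_maximal T t x p :
    pairwise_on (@compatible V G) T -> maxset [in T] t ->
    x \in vertex_set t -> path (spanning_adj (\bigcup_(s in T) s)) x p ->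
  path (spanning_adj t) x p.
Proof.
move=> cT max_t; elim: p x => //= y p IHp x tx /andP[xy yp].
have txy := spanning_adj_maximal cT max_t tx xy.
apply/andP; split; [exact: txy | apply: IHp => //].
have /spanning_adjP[e te De] := txy.
by apply/vertex_setP; exists e; rewrite // De set22.
Qed.

Lemma acyclic_bigcup_subtrees T :
  compatible_subtrees T -> acyclic (spanning_subgraph (\bigcup_(t in T) t)).
Proof.
case/andP=> /forall_inP tT cT; apply/acyclicP=> c c_gt2 /andP[].
case: c c_gt2 => [|x [|y c]] // c_gt2 Tc Uc.
have /andP[/spanning_adjP[e /bigcupP[s Ts se] De] _] := Tc.
have [t max_t sst] := @maxset_exists _ [in T] s Ts.
have /and3P[_ _ /acyclicP/(_ _ c_gt2)[]] := tT t (maxsetp max_t).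
(* A cycle through [x] is a closed path from [x], and distinctness of its vertices does not depend
   on the edge set. *)
rewrite /ucycle Uc andbT; apply: (spanning_path_maximal cT max_t) Tc.
by apply/vertex_setP; exists e; rewrite ?De ?set21 ?(subsetP sst).
Qed.

(** A cycle of length at least 3 uses three distinct edges, too many for a pair. *)
Lemma delta_graph_line_graph : delta_graph (graphic_matroid G) (line_graph G).
Proof.
apply/subsetP=> _ /imsetP[[e f] _ ->] /=; rewrite inE.
apply/acyclicP=> -[|x [|y [|z c]]] // _ /andP[].
rewrite /cycle /= rcons_path => /and4P[xy yz _ wx] /andP[].
rewrite !inE !negb_or => /and3P[nxy nxz ncx] /and3P[/andP[nyz ncy] _ _].
(* The edges xy, yz and wx, where w closes the cycle, are distinct. *)
set w := last z c in wx.
have [nxw nyw] : x != w /\ y != w.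
  (* For a triangle [c] is empty and [w] is [z]; in every case [w] lies in [z :: c], which avoids
     [x] and [y]. *)
  have zcw : w \in z :: c by exact: mem_last.
  by split; apply: contraTneq zcw => <-; rewrite inE negb_or ?nxz ?nyz.
have /spanning_adjP[g1 Ag1 D1] := xy; have /spanning_adjP[g2 Ag2 D2] := yz.
have /spanning_adjP[g3 Ag3 D3] := wx.
(* The vertex [x] tells [g2] apart from [g1] and [g3]; the vertex [y] tells [g1] apart from [g3]. *)
have x1 : x \in val g1 by rewrite D1 set21.
have x2 : x \notin val g2 by rewrite D2 !inE negb_or nxy.
have x3 : x \in val g3 by rewrite D3 set22.
have y1 : y \in val g1 by rewrite D1 set22.
have y3 : y \notin val g3 by rewrite D3 !inE negb_or nyw eq_sym.
have n12 : g1 != g2 by apply: contraNneq x2 => <-.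
have n32 : g3 != g2 by apply: contraNneq x2 => <-.
have n13 : g1 != g3 by apply: contraNneq y3 => <-.
move: Ag1 Ag2 Ag3 n12 n32 n13; rewrite !inE.
by do 3![case/orP=> /eqP->]; rewrite ?eqxx.
Qed.

End SubtreesAndTubes.

Theorem proposition2p4p2 (V : finType) (G : sgraph V) :
  delta_graph (graphic_matroid G) (line_graph G) /\
  subtree_complex G = tubing_complex (graphic_matroid G) (line_graph G).
Proof.
split; first exact: delta_graph_line_graph.
apply: val_inj; apply/setP=> T /=; rewrite !inE /tubing.
rewrite pairwise_weakly_compatible inE andbA.
have ->: [forall t in T, tube (graphic_matroid G) (line_graph G) t] =
         [forall t in T, subtree t].
  by apply: eq_forallb => t; rewrite tube_subtree.
(* The face condition on the union is the one clause of [tubing] without a counterpart for subtrees;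
   compatibility implies it. *)
by apply/idP/andP => [cT | [] //]; rewrite acyclic_bigcup_subtrees.
Qed.
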